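(* Let $S$ be a subset of the real Banach space $X$ which is closed under nonnegative scalar multiplication, and let $f\in Lip_0^{ph}(S)$. Then $f$ can be extended to $X$ preserving the same Lipschitz constant.
   Context: For a set $S\subset X$ closed under nonnegative scalar multiplication (so that $0\in S$), equipped with the metric induced by the norm of $X$, $Lip_0^{ph}(S)$ is the space of Lipschitz functions $f:S\to\mathbb{R}$ with $f(0)=0$ and $f(\alpha x)=\alpha f(x)$ for all $\alpha\ge0$, $x\in S$. The Lipschitz constant of a function $f$ is $Lip(f)=\sup_{x\neq w}\frac{|f(x)-f(w)|}{\|x-w\|}$, the supremum being over distinct points of its domain. *)

(* Defs.v *)
From mathcomp Require Import all_boot all_order all_algebra.
From mathcomp Require Import all_classical all_reals all_analysis.
Import Order.TTheory GRing.Theory Num.Theory.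
Import numFieldNormedType.Exports.

Set Implicit Arguments.
Unset Strict Implicit.
Unset Printing Implicit Defensive.

Local Open Scope classical_set_scope.
Local Open Scope ring_scope.

(* Nonemptiness is required so that 0 belongs to S, as 0 = 0 *: x. *)
Definition nonneg_scale_closed (R : realType) (X : normedModType R)
    (S : set X) : Prop :=
  S !=set0 /\ forall (a : R) (x : X), 0 <= a -> S x -> S (a *: x).

(* A function on S is represented by a total function on X; the two
   definitions below depend only on its values on S (given that 0 is in S). *)

Definition Lip0ph (R : realType) (X : normedModType R) (S : set X) :
    set (X -> R) :=
  [set f | [/\ [lipschitz f x | x in S],
               f 0 = 0 &
               forall (a : R) (x : X), 0 <= a -> S x -> f (a *: x) = a * f x]].

(* This is a real supremum: it is meaningful because the quotients are bounded
   when f is Lipschitz on S, and sup set0 = 0 gives the constant 0 when S has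
   at most one point. *)
Definition Lip (R : realType) (X : normedModType R) (S : set X) (f : X -> R) :
    R :=
  sup [set r | exists x w : X,
         [/\ S x, S w, x != w & r = `|f x - f w| / `|x - w|]].

(* Main.v *)
(** McShane's extension [F x = inf_(s in S) (f s + Lip f * `|x - s|)] is
    Lipschitz with constant [Lip f] and agrees with [f] on [S]. For [a > 0] the
    substitution [s = a *: t] permutes the cone [S], so [F] inherits the
    positive homogeneity of [f] and of the norm. *)
Require Import Defs.
From mathcomp Require Import all_boot all_order all_algebra.
From mathcomp Require Import all_classical all_reals all_analysis.
From mathcomp Require Import lra.
Import Order.TTheory GRing.Theory Num.Theory.
Import numFieldNormedType.Exports.

Set Implicit Arguments.
Unset Strict Implicit.
Unset Printing Implicit Defensive.

Local Open Scope classical_set_scope.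
Local Open Scope ring_scope.

Definition Lip_bound (R : realType) (X : normedModType R) (S : set X)
    (f : X -> R) (k : R) : Prop :=
  forall x w : X, S x -> S w -> `|f x - f w| <= k * `|x - w|.

Lemma lipschitz_boundP (R : realType) (X : normedModType R) (S : set X)
    (f : X -> R) :
  [lipschitz f x | x in S] <-> exists k, Lip_bound S f k.
Proof.
split.
  (* The library notion provides a bound for every constant strictly above [M], hence for
     [M + 1]. *)
  move=> [M [_ HM]]; exists (M + 1) => x w Sx Sw.
  by apply: (HM _ _ (x, w)) => //; rewrite ltrDl.
move=> [k Hk]; exists k; split; first exact: num_real.
move=> M kM [x w] [/= Sx Sw]; apply: le_trans (Hk x w Sx Sw) _.
by rewrite ler_wpM2r // ltW.
Qed.

(** Either the supremum exists and dominates some nonnegative quotient, or [sup] takes its default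
    value 0. *)
Lemma Lip_ge0 (R : realType) (X : normedModType R) (S : set X) (f : X -> R) :
  0 <= Lip S f.
Proof.
rewrite /Lip; set Q := (X in sup X).
have [[[r Qr] ubQ]|/sup_out->//] := pselect (has_sup Q).
apply: le_trans (ub_le_sup ubQ Qr).
by case: Qr => x [w [_ _ _ ->]]; rewrite divr_ge0.
Qed.

Lemma Lip_le (R : realType) (X : normedModType R) (S : set X) (f : X -> R)
    (k : R) :
  0 <= k -> Lip_bound S f k -> Lip S f <= k.
Proof.
move=> k0 Hk; rewrite /Lip; set Q := (X in sup X).
(* Without two distinct points in [S] the supremum is 0, and [0 <= k] decides. *)
have [->|Q0] := eqVneq Q set0; first by rewrite sup0.
apply: ge_sup; first exact/set0P.
move=> _ [x [w [Sx Sw xw ->]]].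
by rewrite ler_pdivrMr ?normr_gt0 ?subr_eq0 //; exact: Hk.
Qed.

Lemma Lip_bound_Lip (R : realType) (X : normedModType R) (S : set X)
    (f : X -> R) :
  [lipschitz f x | x in S] -> Lip_bound S f (Lip S f).
Proof.
move=> /lipschitz_boundP[k Hk] x w Sx Sw.
have [->|xw] := eqVneq x w; first by rewrite !subrr !normr0 mulr0.
rewrite -ler_pdivrMr ?normr_gt0 ?subr_eq0 //.
apply: ub_le_sup; last by exists x, w.
exists k => _ [y [z [Sy Sz yz ->]]].
by rewrite ler_pdivrMr ?normr_gt0 ?subr_eq0 //; exact: Hk.
Qed.

Section McShane.
Context {R : realType} {X : normedModType R}.
Variables (S : set X) (f : X -> R) (k : R).
Hypotheses (S0 : S !=set0) (k0 : 0 <= k) (fk : Lip_bound S f k).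

Definition mcshane (x : X) : R := inf [set f s + k * `|x - s| | s in S].

Lemma mcshane_le (x s : X) : S s -> mcshane x <= f s + k * `|x - s|.
Proof using k0 fk.
move=> Ss; apply: ge_inf; last by exists s.
(* The infimum is over a set bounded below, since [f s - f t] is at most [k] times the distance from
   [s] to [t], which is split at [x]. *)
exists (f s - k * `|x - s|) => _ [t St <-].
have := fk Ss St; rewrite ler_norml => /andP[_ fst].
have := ler_wpM2l k0 (ler_distD x s t).
rewrite (distrC s x) mulrDr; lra.
Qed.

Lemma mcshane_ge (x : X) (c : R) :
  (forall s, S s -> c <= f s + k * `|x - s|) -> c <= mcshane x.
Proof using S0.
move=> cS; apply: lb_le_inf; first exact: image_nonempty.
by move=> _ [s Ss <-]; exact: cS.
Qed.

Lemma mcshane_eq (x : X) : S x -> mcshane x = f x.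
Proof using S0 k0 fk.
move=> Sx; apply/eqP; rewrite eq_le; apply/andP; split.
  by apply: le_trans (mcshane_le x Sx) _; rewrite subrr normr0 mulr0 addr0.
apply: mcshane_ge => s Ss; have := fk Sx Ss.
rewrite ler_norml => /andP[_]; lra.
Qed.

Lemma mcshane_Lip_bound : Lip_bound [set: X] mcshane k.
Proof using S0 k0 fk.
(* One side suffices, as [x] and [w] can be exchanged; it is the triangle inequality under the
   infimum. *)
have le1 x w : mcshane x - k * `|x - w| <= mcshane w.
  apply: mcshane_ge => s Ss; have := mcshane_le x Ss.
  have := ler_wpM2l k0 (ler_distD w x s); rewrite mulrDr; lra.
move=> x w _ _; have := le1 x w; have := le1 w x.
rewrite (distrC w x) ler_norml => ? ?; apply/andP; split; lra.
Qed.

Hypothesis Sscale : forall (a : R) (x : X), 0 <= a -> S x -> S (a *: x).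
Hypothesis fscale :
  forall (a : R) (x : X), 0 <= a -> S x -> f (a *: x) = a * f x.

Lemma mcshane_scale (a : R) (x : X) :
  0 <= a -> mcshane (a *: x) = a * mcshane x.
Proof using S0 k0 fk Sscale fscale.
have le1 b y : 0 < b -> mcshane (b *: y) <= b * mcshane y.
  move=> b0; rewrite mulrC -ler_pdivrMr //.
  apply: mcshane_ge => s Ss; rewrite ler_pdivrMr //.
  (* The competitor for [b *: y] is [b *: s], which lies in the cone. *)
  apply: le_trans (mcshane_le _ (Sscale (ltW b0) Ss)) _.
  rewrite (fscale (ltW b0) Ss) -scalerBr normrZ gtr0_norm //.
  by rewrite mulrDl (mulrC b) mulrCA (mulrC b).
rewrite le_eqVlt => /predU1P[<-|a0].
  (* For the factor 0, the origin is written [0 *: s] with [s] in [S], where the extension agrees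
     with [f]. *)
  have [s Ss] := S0; rewrite mul0r scale0r -(scale0r s).
  by rewrite mcshane_eq ?fscale ?mul0r //; exact: Sscale.
apply/eqP; rewrite eq_le le1 //=.
(* The reverse inequality is the first one for the inverse factor at the point [a *: x]. *)
have := le1 a^-1 (a *: x); rewrite invr_gt0 => /(_ a0).
by rewrite scalerA mulVf ?gt_eqF // scale1r mulrC ler_pdivlMr // mulrC.
Qed.

End McShane.

Theorem proposition4p1 (R : realType) (X : completeNormedModType R)
    (S : set X) (f : X -> R) :
  nonneg_scale_closed S ->
  Lip0ph S f ->
  exists F : X -> R,
    [/\ Lip0ph [set: X] F,
        forall x : X, S x -> F x = f x &
        Lip [set: X] F = Lip S f].
Proof.
move=> [S0 Sscale] [fL f0 fscale].
have L0 := Lip_ge0 S f; have fk := Lip_bound_Lip fL.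
have Fk := mcshane_Lip_bound S0 L0 fk.
have FS := mcshane_eq S0 L0 fk.
have FL : [lipschitz mcshane S f (Lip S f) x | x in [set: X]].
  by apply/lipschitz_boundP; exists (Lip S f).
have Fscale := mcshane_scale S0 L0 fk Sscale fscale.
exists (mcshane S f (Lip S f)); split => //.
  split => //; last by move=> a x a0 _; exact: Fscale.
  by rewrite -(scale0r (0 : X)) Fscale // mul0r.
(* The extension has bound [Lip S f] by construction; conversely, any bound for it on [X] restricts
   to a bound for [f] on [S]. *)
apply/eqP; rewrite eq_le Lip_le //=; apply: Lip_le; first exact: Lip_ge0.
by move=> x w Sx Sw; rewrite -!FS //; exact: (Lip_bound_Lip FL).
Qed.
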